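(* Let $g$ be a non-negative normalized random variable (the power channel coefficient of a fading channel) with probability density function $f_g$ and cumulative distribution function $F_g$, and let $g_{\min}$ be the lower limit of the support of its distribution. Consider the outage probability $$P_{\rm op}=\Pr(W<W_{\rm th})=\int_{g_{\min}}^{W_{\rm th}/\Omega} f_g(g)\,dg=F_g(W_{\rm th}/\Omega),$$ where $W=g\,\Omega$ is the received signal power, $\Omega>0$ is the average received power, and $W_{\rm th}>0$ is a threshold power. Then the outage probability around the operation point $\Omega_0$ can be approximated (in the sense of the linear approximation of the log-CDF described in the context) as $$P_{\rm op}\approx \alpha_0\left(\frac{\Omega_0}{\Omega}\right)^{\delta},$$ where $$\alpha_0=F_g(W_{\rm th}/\Omega_0),\qquad \delta=\frac{W_{\rm th}}{\Omega_0}\,\frac{f_g(W_{\rm th}/\Omega_0)}{F_g(W_{\rm th}/\Omega_0)}.$$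
   Context: The quantity $W_{\rm th}$ is the minimal received power required to decode a packet correctly at the given transmission rate, and $\Omega$ is deterministic. The superscript dB denotes the transformation $10\log_{10}(\cdot)$. The approximation is the linear approximation of the log-CDF in log-log scale around the operating point: with $x=\Omega^{\rm dB}$, $x_0=\Omega_0^{\rm dB}$, and $\mathcal{G}(x)=\log_{10}F_g(W_{\rm th}/\Omega)$ regarded as a function of $x$, one approximates $\mathcal{G}(x)$ around $x_0$ by $T(x,x_0)=\mathcal{G}'(x_0)(x-x_0)+\mathcal{G}(x_0)$, where $\mathcal{G}'(x_0)$ is the derivative of $\mathcal{G}$ with respect to $x$ at $x_0$. The number $\delta$ is called the operational diversity order (ODO) at $\Omega_0$, and $\alpha_0$ is interpreted as an operational power offset.
   Formalization: The density f_g is assumed to have a Lebesgue point at W_th/Ω_0 (true if it is continuous there), and F_g(W_th/Ω_0) is assumed positive; without these the formula can fail, since a density may be altered at one point, or δ is undefined. *)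

(* Defs.v *)
(* MathComp-Analysis, over an arbitrary realType. *)
From HB Require Import structures.
From mathcomp Require Export all_boot all_order all_algebra.
From mathcomp Require Export all_classical all_reals all_analysis.
Export Order.TTheory GRing.Theory Num.Theory.
Export numFieldNormedType.Exports.

Set Implicit Arguments.
Unset Strict Implicit.
Unset Printing Implicit Defensive.

Local Open Scope classical_set_scope.
Local Open Scope ring_scope.

Definition log10 (R : realType) (z : R) : R := ln z / ln 10.

Definition dB (R : realType) (z : R) : R := 10 * log10 z.

(* Inverse of [dB] on positive reals. *)
Definition undB (R : realType) (x : R) : R := 10 `^ (x / 10).

Section outage.
Context (d : measure_display) (T : measurableType d) (R : realType).
Context (P : probability T R) (g : {RV P >-> R}).

Definition is_pdf (f : R -> R) : Prop :=
  [/\ measurable_fun setT f, (forall t, 0 <= f t) &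
      forall A : set R, measurable A ->
        distribution P g A = (\int[lebesgue_measure]_(t in A) (f t)%:E)%E].

Definition support_of : set R :=
  [set t | forall e : R, 0 < e -> (0 < distribution P g (ball t e))%E].

(* [inf] is the genuine infimum only on nonempty sets bounded from below; the
   support of the law of a non-negative random variable is one. *)
Definition support_min : R := inf support_of.

(* The library's [cdf] is extended-real valued. *)
Definition Fcdf (u : R) : R := fine (cdf g u).

Definition outage_prob (Wth Omega : R) : \bar R :=
  P [set w | g w * Omega < Wth].

(* log10 of the CDF at Wth / Omega, as a function of x = dB Omega. *)
Definition log_cdf (Wth x : R) : R := log10 (Fcdf (Wth / undB x)).

Definition power_offset (Wth Omega0 : R) : R := Fcdf (Wth / Omega0).

Definition odo (f : R -> R) (Wth Omega0 : R) : R :=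
  Wth / Omega0 * (f (Wth / Omega0) / Fcdf (Wth / Omega0)).

End outage.

(* Approximates G only where G is derivable at x0: otherwise the derivative is
   an unspecified value. *)
Definition linear_approx (R : realType) (G : R -> R) (x0 x : R) : R :=
  G^`()%classic x0 * (x - x0) + G x0.

(* Main.v *)
(** At a Lebesgue point of its density the CDF is differentiable, so the chain
    rule, applied to x |-> Wth / 10 ^ (x / 10), gives the log-CDF the slope
    - delta / 10 at the operating point; exponentiating the tangent line
    turns it into the power law.  The integral may start at the minimum of the
    support because the law gives no mass to the points below it. *)
Require Import Defs.
From mathcomp Require Import measurable_realfun ring.
Set Implicit Arguments.
Unset Strict Implicit.

Local Open Scope classical_set_scope.
Local Open Scope ring_scope.

Section decibel.
Context (R : realType).
Implicit Types x z : R.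

Lemma ln10_neq0 : ln 10 != 0 :> R.
Proof. by rewrite gt_eqF// ln_gt0// ltr1n. Qed.

Lemma powR10E x : 10 `^ x = expR (x * ln 10) :> R.
Proof. by rewrite /powR pnatr_eq0. Qed.

Lemma log10_powR10 x : log10 (10 `^ x) = x.
Proof. by rewrite /log10 ln_powR mulfK// ln10_neq0. Qed.

Lemma powR10_log10 z : 0 < z -> 10 `^ (log10 z) = z.
Proof. by move=> z0; rewrite powR10E /log10 divfK ?ln10_neq0// lnK. Qed.

Lemma undB_gt0 x : 0 < undB x.
Proof. by rewrite powR_gt0// ltr0n. Qed.

Lemma undBK : cancel (@undB R) (@dB R).
Proof. by move=> x; rewrite /dB log10_powR10 mulrC divfK// pnatr_eq0. Qed.

Lemma dBK z : 0 < z -> undB (dB z) = z.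
Proof.
by move=> z0; rewrite /undB /dB [10 * _]mulrC mulfK ?pnatr_eq0// powR10_log10.
Qed.

Lemma is_derive_log10 z : 0 < z -> is_derive z 1 (@log10 R) ((ln 10)^-1 / z).
Proof.
move=> z0.
rewrite (_ : @log10 R = (ln 10)^-1 \*: (@ln R)); last first.
  by apply/funext => y; rewrite /log10 /= /GRing.scale /= mulrC.
by apply: is_deriveZ; exact: is_derive1_ln.
Qed.

(** The function is the exponential [c * expR (- (ln 10 / 10) * y)], so its derivative is itself
    times the rate. With [c] the threshold power it is the inner map of the log-CDF. *)
Lemma is_derive_div_undB c x :
  is_derive x 1 (fun y : R => c / undB y) (- (c / undB x * (ln 10 / 10))).
Proof.
have E y : c / undB y = c * expR (- (ln 10 / 10) * y).
  by rewrite /undB powR10E -expRN; congr (_ * expR _); ring.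
rewrite E (_ : (fun y => _) = c \*: (expR \o ( - (ln 10 / 10) \*: id))); last first.
  by apply/funext => y; rewrite E.
have dl : is_derive x 1 (- (ln 10 / 10) \*: id : R -> R) (- (ln 10 / 10) *: 1).
  exact: is_deriveZ.
apply: is_derive_eq (is_deriveZ c (is_derive1_comp (is_derive_expR _) dl)) _.
by rewrite /GRing.scale /= mulr1 /GRing.scale/=; ring.
Qed.

End decibel.

Section random_variable.
Context (d : measure_display) (T : measurableType d) (R : realType).
Context (P : probability T R) (g : {RV P >-> R}).
Local Notation mu := (@lebesgue_measure R).

Lemma Fcdf_cdf u : (Fcdf g u)%:E = cdf g u.
Proof. by rewrite fineK// fin_num_measure. Qed.

Lemma outage_probE Wth Omega : 0 < Omega ->
  outage_prob g Wth Omega = distribution P g `]-oo, Wth / Omega[.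
Proof.
move=> Omega0; congr (P _); apply/seteqP; split=> w /=; rewrite in_itv/=.
  by rewrite ltr_pdivlMr.
by rewrite ltr_pdivlMr.
Qed.

Section nonnegative.
Hypothesis g_ge0 : forall w, 0 <= g w.

Lemma distribution_lt0 A : A `<=` `]-oo, 0[ -> distribution P g A = 0%E.
Proof.
move=> A0; rewrite /distribution /pushforward (_ : _ @^-1` _ = set0) ?measure0//.
apply/seteqP; split=> // w /= /A0 /=; rewrite in_itv/= => /lt_geF.
by rewrite g_ge0.
Qed.

Lemma support_ge0 t : support_of g t -> 0 <= t.
Proof.
move=> gt; rewrite leNgt; apply/negP => t0.
have := gt (- t); rewrite oppr_gt0 => /(_ t0); rewrite distribution_lt0 ?ltxx//.
move=> x; rewrite ball_itv/= !in_itv/= => /andP[_].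
by rewrite subrr.
Qed.

(* Were F c positive, the infimum of the points where F is positive would be a
   point of the support lying below c. *)
Lemma cdf_lt_support_min c : c < support_min g -> cdf g c = 0%E.
Proof.
move=> cm; apply/eqP; rewrite eq_le measure_ge0 andbT leNgt; apply/negP => Fc.
pose B := [set u | (0 < cdf g u)%E].
have Blb : lbound B 0.
  move=> u Bu; rewrite leNgt; apply/negP => u0; move: Bu; rewrite /B/= /cdf.
  rewrite distribution_lt0 ?ltxx// => x /=; rewrite !in_itv/= => xu.
  exact: le_lt_trans u0.
have hB : has_inf B by split; [exists c | exists 0].
have sc : inf B <= c by apply: ge_inf => //; exists 0.
suff ss : support_of g (inf B).
  (* Since 0 bounds the support from below, its [inf] is a genuine infimum and lies below the
     support point [inf B]. *)
  have : support_min g <= inf B.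
    by apply: ge_inf => //; exists 0 => t; exact: support_ge0.
  by move=> /le_lt_trans/(_ (le_lt_trans sc cm)); rewrite ltxx.
move=> e e0.
have [u Bu ue] : exists2 u, B u & u < inf B + e.
  by apply: inf_adherent.
(* No mass lies up to [inf B - e / 2], so the positive mass of []-oo, u]] must fall in the ball,
   which reaches beyond [u]. *)
have F0 : cdf g (inf B - e / 2) = 0%E.
  apply/eqP; rewrite eq_le measure_ge0 andbT leNgt; apply/negP => Fe.
  have : inf B <= inf B - e / 2 by apply: ge_inf => //; exists 0.
  by rewrite lerBrDr gerDl leNgt divr_gt0.
apply: (lt_le_trans Bu); rewrite /cdf.
have mball : measurable (ball (inf B) e) by rewrite ball_itv.
apply: (@le_trans _ _ (distribution P g (`]-oo, inf B - e / 2] `|` ball (inf B) e))).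
  apply: le_measure; rewrite ?inE//; first exact: measurableU.
  move=> x /=; rewrite ball_itv/= !in_itv/= => xu.
  have [|xe] := leP x (inf B - e / 2); [by left|right].
  rewrite (le_lt_trans xu ue) andbT (le_lt_trans _ xe)// lerD2l lerN2.
  by rewrite ler_pdivrMr// ler_pMr// ler1n.
apply: (le_trans (measureU2 _ _ _)) => //.
by rewrite -[leRHS]add0e; apply: leeD => //; rewrite -[leRHS]F0.
Qed.

(** The open half-line is a countable union of closed half-lines ending strictly before the minimum
    of the support, each of them null. *)
Lemma distribution_lt_support_min :
  distribution P g `]-oo, support_min g[ = 0%E.
Proof.
rewrite (_ : `]-oo, _[%classic =
    \bigcup_n `]-oo, support_min g - n.+1%:R^-1]%classic); last first.
  apply/seteqP; split=> [x /=|x [n _] /=]; rewrite !in_itv/=.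
    rewrite -subr_gt0 => xm; have [n /= _ nx] := near_infty_natSinv_lt (PosNum xm).
    exists n => //=; rewrite in_itv/= lerBrDr -lerBrDl ltW//.
    by apply: nx => /=.
  by move=> /le_lt_trans; apply; rewrite gtrBl invr_gt0.
apply/measure_negligible.
  by apply: bigcup_measurable.
apply: negligible_bigcup => n; apply/negligibleP => //.
by apply: cdf_lt_support_min; rewrite gtrBl invr_gt0.
Qed.

Lemma distribution_support_min u :
  distribution P g `]-oo, u] = distribution P g `[support_min g, u].
Proof.
apply/eqP; rewrite eq_le; apply/andP; split; last first.
  by apply: le_measure; rewrite ?inE// => x /=; rewrite !in_itv/= => /andP[].
apply: (@le_trans _ _ (distribution P g
    (`]-oo, support_min g[ `|` `[support_min g, u]))).
  apply: le_measure; rewrite ?inE//; first exact: measurableU.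
  move=> x /=; rewrite !in_itv/= => xu.
  by have [|] := leP (support_min g) x; [right|left].
apply: (le_trans (measureU2 _ _ _)) => //.
rewrite -[leRHS]add0e; apply: leeD => //.
by rewrite -[leRHS]distribution_lt_support_min.
Qed.

End nonnegative.

Section density.
Variable f : R -> R.
Hypothesis f_pdf : is_pdf g f.

Lemma pdf_distribution A : measurable A ->
  distribution P g A = (\int[mu]_(t in A) (f t)%:E)%E.
Proof. by case: f_pdf => _ _; exact. Qed.

(** A law with a density has no atom. This reconciles the strict inequality in the outage event with
    the large one in the CDF. *)
Lemma pdf_distribution_lt u :
  distribution P g `]-oo, u[ = distribution P g `]-oo, u].
Proof.
case: f_pdf => mf _ _; rewrite !pdf_distribution// integral_itv_bndo_bndc//.
by apply/measurable_EFinP; exact: measurable_funTS.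
Qed.

Lemma pdf_integrable A : measurable A -> mu.-integrable A (EFin \o f).
Proof.
case: f_pdf => mf f0 _ mA; apply/integrableP; split.
  by apply/measurable_EFinP; exact: measurable_funTS.
under eq_integral do rewrite /= ger0_norm//.
by rewrite -pdf_distribution// ltey_eq fin_num_measure.
Qed.

(** The CDF is the integral of [f] from minus infinity, so this is the first fundamental theorem of
    calculus at a Lebesgue point. *)
Lemma is_derive_Fcdf u : lebesgue_pt f u -> is_derive u 1 (Fcdf g) (f u).
Proof.
move=> fu.
(* The bound [u + 1] is arbitrary: it only makes [u] interior to the domain of integrability. *)
have uu : u < u + 1 by rewrite ltrDl.
rewrite (_ : Fcdf g = fun x => \int[mu]_(t in `]-oo, x]) f t); last first.
  by apply/funext => x; rewrite /Fcdf /cdf pdf_distribution.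
have fi : mu.-integrable `]-oo, u + 1] (EFin \o f) by exact: pdf_integrable.
have [|dF fE] := FTC1_lebesgue_pt uu fi _ fu; first by rewrite ltNyr.
by apply: DeriveDef => //; rewrite -derive1E.
Qed.

(** In the chain rule the factor [ln 10] coming from [undB] cancels the one coming from [log10];
    only the 10 of the decibel remains. *)
Lemma is_derive_log_cdf Wth x :
  let u := Wth / undB x in lebesgue_pt f u -> 0 < Fcdf g u ->
  is_derive x 1 (log_cdf g Wth) (- odo g f Wth (undB x) / 10).
Proof.
move=> u fu Fu.
pose h y := Wth / undB y.
have dF : is_derive x 1 (Fcdf g \o h) (f u * - (u * (ln 10 / 10))).
  apply: is_derive1_comp; first exact: is_derive_Fcdf.
  exact: is_derive_div_undB.
have dlog : is_derive ((Fcdf g \o h) x) 1 (@log10 R) ((ln 10)^-1 / Fcdf g u).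
  exact: is_derive_log10.
apply: is_derive_eq (is_derive1_comp dlog dF) _.
rewrite /odo -/u.
have := ln10_neq0 R; move: (ln 10) => l l0.
by field; rewrite l0 gt_eqF.
Qed.

End density.

(** Pure algebra once the slope is known: the constant term exponentiates to the offset, and the
    factor 10 in [dB] cancels the 10 dividing the slope, leaving [odo] times
    [log10 (Omega0 / Omega)]. *)
Lemma powR10_linear_approx_log_cdf (f : R -> R) Wth Omega0 Omega :
  0 < Omega0 -> 0 < Omega -> 0 < Fcdf g (Wth / Omega0) ->
  (log_cdf g Wth)^`()%classic (dB Omega0) = - odo g f Wth Omega0 / 10 ->
  10 `^ (linear_approx (log_cdf g Wth) (dB Omega0) (dB Omega)) =
  power_offset g Wth Omega0 * (Omega0 / Omega) `^ (odo g f Wth Omega0).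
Proof.
move=> O0 O F0 dG; rewrite /linear_approx dG /log_cdf dBK//.
rewrite powRD ?pnatr_eq0 ?implybT// powR10_log10// mulrC; congr (_ * _).
rewrite powR10E /powR gt_eqF ?divr_gt0// ln_div// /dB /log10; congr expR.
have := ln10_neq0 R; move: (ln 10) => l l0.
by field.
Qed.

End random_variable.

Lemma linear_approx_error (R : realType) (G : R -> R) (x0 : R) :
  derivable G x0 1 ->
  (G x - linear_approx G x0 x) / (x - x0) @[x --> x0^'] --> 0.
Proof.
move=> dG.
have : (G x - G x0) / (x - x0) @[x --> x0^'] --> G^`()%classic x0.
  move/cvg_ex : dG => [l dl]; rewrite derive1E /derive.
  rewrite (cvg_lim _ dl)//.
  apply/cvgrPdist_lt => e e0; move/cvgrPdist_lt/(_ e e0) : dl.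
  (* The derivative is a limit in the increment at 0; substituting [x - x0] for the increment moves
     it to [x0]. *)
  rewrite !near_withinE !near_simpl (near_shift x0 0); apply: filterS => x /=.
  rewrite sub0r subr_eq0 => + /[dup] xx0 => /[apply].
  by rewrite /GRing.scale /= mulr1 subrK mulrC.
move=> /cvgB/(_ (cvg_cst (G^`()%classic x0))); rewrite subrr.
(* Away from [x0], the scaled error is the difference quotient minus the derivative. *)
apply: cvg_trans; apply: near_eq_cvg; near=> x.
have xx0 : x - x0 != 0 by rewrite subr_eq0; near: x; exact: nbhs_dnbhs_neq.
by rewrite /linear_approx !fctE; field.
Unshelve. all: by end_near. Qed.

(** The sign of approximation is made precise by the last two clauses: the power law is exactly the
    exponentiated tangent line, and its error in log-log scale is [o(x - x0)] with
    [x0 = dB Omega0]. *)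
Theorem lemma1 (d : measure_display) (T : measurableType d) (R : realType)
    (P : probability T R) (g : {RV P >-> R}) (f : R -> R) (Wth Omega0 : R)
    (g_ge0 : forall w, 0 <= g w)
    (g_normalized : ('E_P[g] = 1)%E)
    (f_pdf : is_pdf g f)
    (Wth_gt0 : 0 < Wth) (Omega0_gt0 : 0 < Omega0)
    (* regularity of f_g at the operating point; implied by continuity there *)
    (f_reg : lebesgue_pt f (Wth / Omega0))
    (F_gt0 : 0 < Fcdf g (Wth / Omega0)) :
  let alpha0 := power_offset g Wth Omega0 in
  let delta := odo g f Wth Omega0 in
  let G := log_cdf g Wth in
  let approx := fun Omega : R => alpha0 * (Omega0 / Omega) `^ delta in
  [/\ forall Omega : R, 0 < Omega ->
        outage_prob g Wth Omega =
          (\int[lebesgue_measure]_(t in `[support_min g, (Wth / Omega)%R])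
             (f t)%:E)%E
        /\ outage_prob g Wth Omega = (Fcdf g (Wth / Omega))%:E,
      derivable G (dB Omega0) 1,
      forall Omega : R, 0 < Omega ->
        10 `^ (linear_approx G (dB Omega0) (dB Omega)) = approx Omega
    & (log10 (fine (outage_prob g Wth (undB x))) - log10 (approx (undB x)))
        / (x - dB Omega0) @[x --> (dB Omega0)^'] --> 0 ].
Proof.
move=> alpha0 delta G approx.
have dG : is_derive (dB Omega0) 1 G (- delta / 10).
  have /= := is_derive_log_cdf f_pdf (Wth := Wth) (x := dB Omega0).
  by rewrite dBK//; apply.
have opE Omega : 0 < Omega ->
    outage_prob g Wth Omega = (Fcdf g (Wth / Omega))%:E.
  by move=> O; rewrite outage_probE// (pdf_distribution_lt f_pdf) Fcdf_cdf.
have linE Omega : 0 < Omega ->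
    10 `^ (linear_approx G (dB Omega0) (dB Omega)) = approx Omega.
  move=> O; apply: powR10_linear_approx_log_cdf => //.
  by rewrite derive1E derive_val.
split; [move=> Omega O; split; last exact: opE | exact: ex_derive | exact: linE |].
  rewrite outage_probE// (pdf_distribution_lt f_pdf).
  by rewrite distribution_support_min// (pdf_distribution f_pdf).
(* In log-log scale the outage probability is [G] and the power law is its tangent line, for every
   [x]. *)
rewrite (_ : (fun x => _) =
    fun x => (G x - linear_approx G (dB Omega0) x) / (x - dB Omega0)).
  exact: linear_approx_error.
apply/funext => x.
by rewrite -linE ?undB_gt0// undBK log10_powR10 opE ?undB_gt0.
Qed.
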